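(* Consider the deterministic robust MDP with state set $\{s_1,s_2,s_+\}$, actions $a_1,a_2$ at $s_1$ and $s_2$ (transitions out of $s_+$ do not depend on the action), discount factor $\gamma=0.9$, initial distribution $\mu(s_1)=\mu(s_2)=0.45$, $\mu(s_+)=0.1$, cost $c(s_+,\cdot)=1$ and $c(s_1,\cdot)=c(s_2,\cdot)=0$, and transition uncertainty set $\mathcal{P}=\{P_1,P_2\}$, where under $P_1$: $(s_1,a_1)\mapsto s_1$, $(s_1,a_2)\mapsto s_+$, $(s_2,a_1)\mapsto s_1$, $(s_2,a_2)\mapsto s_2$, $s_+\mapsto s_2$; and $P_2$ is obtained from $P_1$ by exchanging the roles of $s_1$ and $s_2$, i.e. $(s_2,a_1)\mapsto s_2$, $(s_2,a_2)\mapsto s_+$, $(s_1,a_1)\mapsto s_2$, $(s_1,a_2)\mapsto s_1$, $s_+\mapsto s_1$. Let $\tilde\pi_1$ (resp. $\tilde\pi_2$) be the policy that always chooses $a_1$ (resp. $a_2$). Then: (1) $\tilde\pi_2$ is a suboptimal strict local minimum of $J_{\mathcal{P}}$ over the set $\Pi$ of policies, and $0.505=J_{\mathcal{P}}(\tilde\pi_2)>J_{\mathcal{P}}(\tilde\pi_1)=0.1$. (2) For all sufficiently small $\eta>0$, every sequence initialized at $\pi_0=\tilde\pi_2$ and generated by $\pi_{t+1}=\mathrm{Proj}_{\Pi}(\pi_t-\eta g_t)$ with any choice of $g_t\in\partial J_{\mathcal{P}}(\pi_t)$ satisfies $\|\pi_t-\tilde\pi_2\|_\infty\le 3\eta$ for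 all $t\ge 0$.
   Context: A policy is $\pi=(\pi(a\mid s))$ with $\pi(\cdot\mid s)$ a probability distribution on $\{a_1,a_2\}$ for $s\in\{s_1,s_2\}$; since the action at $s_+$ is irrelevant, policies are identified with their values at $s_1,s_2$ (equivalently, $s_+$ has a single action), and $\Pi\subset\mathbb{R}^{\{s_1,s_2\}\times\{a_1,a_2\}}$ is the set of policies. $\mathrm{Proj}_\Pi$ is Euclidean projection onto $\Pi$. For a transition kernel $P$, $J_P(\pi)=\mathbb{E}^\pi_P\big[\sum_{h\ge 0}\gamma^h c(s_h,a_h)\big]$ with $s_0\sim\mu$, $a_h\sim\pi(\cdot\mid s_h)$, $s_{h+1}\sim P(\cdot\mid s_h,a_h)$, and $J_{\mathcal{P}}(\pi)=\max_{P\in\mathcal{P}}J_P(\pi)$. Let $Q^\pi_P(s,a)$ be the expected discounted total cost under $\pi,P$ starting from $(s,a)$ and $d^\pi_P(s)=(1-\gamma)\mathbb{E}^\pi_P[\sum_{h\ge0}\gamma^h \mathbf{1}\{s_h=s\}]$. The gradient is $(\nabla J_P(\pi))(s,a)=\frac{1}{1-\gamma}d^\pi_P(s)Q^\pi_P(s,a)$, and the (Fréchet) subdifferential is $\partial J_{\mathcal{P}}(\pi)=\mathrm{conv}\{\nabla J_P(\pi): P\in\mathcal{P},\ J_P(\pi)=J_{\mathcal{P}}(\pi)\}$. ''Suboptimal'' means not a global minimizer of $J_{\mathcal{P}}$ over $\Pi$; ''strict local minimum'' means $J_{\mathcal{P}}(\pi)>J_{\mathcal{P}}(\tilde\pi_2)$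 for all $\pi\in\Pi$, $\pi\neq\tilde\pi_2$, in some neighborhood of $\tilde\pi_2$. *)

(* Defs.v *)
From HB Require Import structures.
From mathcomp Require Import all_boot all_order all_algebra.
From mathcomp Require Import all_classical all_reals all_analysis.

Set Implicit Arguments.
Unset Strict Implicit.
Unset Printing Implicit Defensive.

Import Order.TTheory GRing.Theory Num.Theory numFieldNormedType.Exports.

Local Open Scope classical_set_scope.
Local Open Scope ring_scope.

(* Finite discounted Markov decision processes; [P s a s'] is the probability
   of moving from [s] to [s'] under [a], and [p s a] that of playing [a] in
   [s]. *)
Section FiniteMDP.
Variables (R : realType) (S A : finType).

Definition kernel_fun := S -> A -> S -> R.
Definition policy_fun := S -> A -> R.

Implicit Types (nu : S -> A -> R) (p : policy_fun) (P : kernel_fun).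

(* A trajectory (s_0, a_0), ..., (s_n, a_n). *)
Definition trajectory n := {ffun 'I_n.+1 -> S * A}.

(* Probability of a trajectory when (s_0, a_0) has law [nu]. The index
   [widen_ord (leqnSn n) h] has value h and [lift ord0 h] has value h + 1. *)
Definition trajectory_prob nu p P n (w : trajectory n) : R :=
  nu (w ord0).1 (w ord0).2 *
  \prod_(h < n)
     let x := w (widen_ord (leqnSn n) h) in let y := w (lift ord0 h) in
     P x.1 x.2 y.1 * p y.1 y.2.

Definition expectation nu p P n (F : trajectory n -> R) : R :=
  \sum_(w : trajectory n) trajectory_prob nu p P w * F w.

(* E[sum_{h >= 0} gamma^h f(s_h, a_h)], as the limit over n of the expectation
   of the sum up to time n, which only involves trajectories of length n + 1. *)
Definition discounted_value (gamma : R) nu p P (f : S -> A -> R) : R :=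
  limn (fun n => expectation nu p P (fun w : trajectory n =>
    \sum_(h < n.+1) gamma ^+ h * f (w h).1 (w h).2)).

Definition initial_law (mu : S -> R) p (s : S) (a : A) : R := mu s * p s a.

Definition expected_cost gamma (mu : S -> R) (c : S -> A -> R) p P : R :=
  discounted_value gamma (initial_law mu p) p P c.

Definition Qvalue gamma (c : S -> A -> R) p P (s : S) (a : A) : R :=
  discounted_value gamma (fun s0 a0 => ((s0, a0) == (s, a))%:R) p P c.

Definition occupancy gamma (mu : S -> R) p P (s : S) : R :=
  (1 - gamma) *
  discounted_value gamma (initial_law mu p) p P (fun s' _ => (s' == s)%:R).

Definition deterministic_kernel (next : S -> A -> S) : kernel_fun :=
  fun s a s' => (s' == next s a)%:R.

End FiniteMDP.

Section Optimization.
Variables (R : realType) (m n : nat).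
Implicit Types (C : set 'M[R]_(m.+1, n.+1)) (f : 'M[R]_(m.+1, n.+1) -> R).
Implicit Types (x y z : 'M[R]_(m.+1, n.+1)).

Definition global_min f C x := C x /\ forall y, C y -> f x <= f y.

Definition strict_local_min f C x :=
  C x /\ \forall y \near x, C y -> y <> x -> f x < f y.

(* The library norm on matrices is the sup norm, hence this definition. *)
Definition euclidean_norm x : R := Num.sqrt (\sum_i \sum_j x i j ^+ 2).

(* [y] is a Euclidean projection of [x] onto [C]. *)
Definition is_proj C x y :=
  C y /\ forall z, C z -> euclidean_norm (x - y) <= euclidean_norm (x - z).

Definition convex_hull C : set 'M[R]_(m.+1, n.+1) :=
  smallest (fun D => convex_set (D : set (convex_lmodType 'M[R]_(m.+1, n.+1)))) C.

End Optimization.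

(* The states s_1 and s_2 are [Some i] with [i : 'I_2], and s_+ is [None]. *)
Definition state := option 'I_2.
Definition action := 'I_2.

Definition s1 : state := Some ord0.
Definition s2 : state := Some ord_max.
Definition splus : state := None.
Definition a1 : action := ord0.
Definition a2 : action := ord_max.

Definition next1 (s : state) (a : action) : state :=
  if s == s1 then (if a == a1 then s1 else splus)
  else if s == s2 then (if a == a1 then s1 else s2)
  else s2.

Definition next2 (s : state) (a : action) : state :=
  if s == s2 then (if a == a1 then s2 else splus)
  else if s == s1 then (if a == a1 then s2 else s1)
  else s1.

Section RobustMDP.
Variable R : realType.

Definition gamma : R := 9 / 10.
Definition mu (s : state) : R := if s == splus then 1 / 10 else 45 / 100.
Definition cost (s : state) (a : action) : R := (s == splus)%:R.

Definition P1 : kernel_fun R state action := deterministic_kernel R next1.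
Definition P2 : kernel_fun R state action := deterministic_kernel R next2.
Definition uncertainty : set (kernel_fun R state action) := [set P1; P2].

(* Row i of a policy is its action distribution at [Some i]. *)
Definition policies : set 'M[R]_2 :=
  [set p | (forall i j, 0 <= p i j) /\ (forall i, \sum_j p i j = 1)].

(* At s_+ the action is irrelevant; it is set to [a1]. *)
Definition extend_policy (p : 'M[R]_2) : policy_fun R state action :=
  fun s a => if s is Some i then p i a else (a == a1)%:R.

Definition J (P : kernel_fun R state action) (p : 'M[R]_2) : R :=
  expected_cost gamma mu cost (extend_policy p) P.

(* A maximum, since the uncertainty set is finite and nonempty. *)
Definition robustJ (p : 'M[R]_2) : R := sup [set J P p | P in uncertainty].

Definition gradJ (P : kernel_fun R state action) (p : 'M[R]_2) : 'M[R]_2 :=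
  \matrix_(i, a) ((1 - gamma)^-1 *
    occupancy gamma mu (extend_policy p) P (Some i) *
    Qvalue gamma cost (extend_policy p) P (Some i) a).

Definition subdifferential (p : 'M[R]_2) : set 'M[R]_2 :=
  convex_hull [set gradJ P p | P in [set P | uncertainty P /\ J P p = robustJ p]].

Definition always (a : action) : 'M[R]_2 := \matrix_(i, j) (j == a)%:R.

(* Iterates of projected subgradient descent with step size [eta], for some
   choice [g] of subgradients. *)
Definition subgradient_run (eta : R) (p g : nat -> 'M[R]_2) :=
  forall t, subdifferential (p t) (g t) /\
            is_proj policies (p t - eta *: g t) (p t.+1).

End RobustMDP.

(* Main.v *)
Require Import Defs.
From mathcomp Require Import all_boot all_order all_algebra.
From mathcomp Require Import all_classical all_reals all_analysis.
From mathcomp Require Import ring lra.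
Set Implicit Arguments.
Unset Strict Implicit.
Unset Printing Implicit Defensive.
Import Order.TTheory GRing.Theory Num.Theory numFieldNormedType.Exports.
Local Open Scope classical_set_scope.
Local Open Scope ring_scope.

(** Exchanging s_1 and s_2 turns one kernel into the other, so both are treated
    as one kernel indexed by a home state i: action a_1 leads home, action a_2
    leads from home to s_+ and otherwise stays put, and s_+ leads to the other
    state j. A policy is determined by x and y, the probabilities of a_1 at i
    and at j, and the always-a_2 policy is the point (0, 0).

    Only visits to s_+ cost anything. Under the kernel with home i, playing a_1
    at i keeps the agent away from s_+, which is good, whereas playing a_1 at j
    returns it to i, whence a_2 sends it to s_+, which is bad. At (0, 0) the
    second effect is far stronger: the partial derivatives of the cost in x and
    y are -0.0405 and 7.326. The other kernel reverses the roles of x and y, so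
    the worst case increases in every direction, although at (1, 1) the cost
    would drop to the unavoidable 0.1.

    The costs and gradients are computed exactly. A discounted value is the
    pairing of the reward with any solution of the flow equations
    ([discounted_value_visits]), and a Q-function is read off any solution of
    the Bellman equations ([Qvalue_bellman]); both systems have three unknowns
    and rational solutions ([visits_flow], [value_bellman]).

    For the descent method, the iterates stay on the two edges xy = 0, within
    distance eta of (0, 0) ([step_invariant]). On the edge x = 0 with
    y > 0 the kernel with home i is the only worst case, and its gradient sends
    y back to 0 in a single step while x moves by at most eta. At (0, 0) both
    kernels are worst cases, but every subgradient is nonnegative along one of
    the two coordinates, which then stays at 0, while the other moves by at most
    eta. *)

(** * Discounted values of a finite Markov decision process *)

Section DiscountedValue.
Variables (R : realType) (S A : finType).
Variables (p : policy_fun R S A) (P : kernel_fun R S A).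
Hypothesis P_ge0 : forall s a s', 0 <= P s a s'.
Hypothesis P_sum1 : forall s a, \sum_s' P s a s' = 1.
Hypothesis p_ge0 : forall s a, 0 <= p s a.
Hypothesis p_sum1 : forall s, \sum_a p s a = 1.

Implicit Types (f m q nu : S * A -> R) (x y : S * A).

(** Under [p] and [P] the state-action pairs form a Markov chain with this
    kernel; [next_mean] is its action on functions. *)
Definition pair_kernel x y : R := P x.1 x.2 y.1 * p y.1 y.2.
Definition next_mean f x : R := \sum_y pair_kernel x y * f y.
Definition pairing nu f : R := \sum_x nu x * f x.

Lemma pair_kernel_sum1 x : \sum_y pair_kernel x y = 1.
Proof.
rewrite /pair_kernel -(pair_big xpredT xpredT (fun s a => P x.1 x.2 s * p s a)) /=.
by rewrite -[RHS](P_sum1 x.1 x.2); apply: eq_bigr => s _; rewrite -mulr_sumr p_sum1 mulr1.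
Qed.

Lemma next_mean_bound f (M : R) :
  (forall x, `|f x| <= M) -> forall x, `|next_mean f x| <= M.
Proof.
move=> fM x; rewrite -[M]mul1r -(pair_kernel_sum1 x) mulr_suml.
apply: (le_trans (ler_norm_sum _ _ _)); apply: ler_sum => y _.
by rewrite normrM ger0_norm ?mulr_ge0// ler_wpM2l// mulr_ge0.
Qed.

Lemma iter_next_mean_bound f (M : R) k :
  (forall x, `|f x| <= M) -> forall x, `|iter k next_mean f x| <= M.
Proof. by move=> fM; elim: k => //= k IH; exact: next_mean_bound. Qed.

Definition truncated (g : R) f n x : R := \sum_(h < n) g ^+ h * iter h next_mean f x.

Lemma next_mean_truncated g f n x :
  next_mean (truncated g f n) x = \sum_(h < n) g ^+ h * iter h.+1 next_mean f x.
Proof.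
rewrite /next_mean /truncated.
under eq_bigr do rewrite mulr_sumr.
rewrite exchange_big; apply: eq_bigr => h _ /=; rewrite /next_mean mulr_sumr.
by apply: eq_bigr => y _; rewrite mulrCA.
Qed.

Lemma truncatedS g f n x :
  truncated g f n.+1 x = f x + g * next_mean (truncated g f n) x.
Proof.
rewrite {1}/truncated big_ord_recl/= mul1r next_mean_truncated mulr_sumr.
by congr (_ + _); apply: eq_bigr => h _; rewrite /= exprS mulrA.
Qed.

Definition traj_cons n (x : S * A) (w : trajectory S A n) : trajectory S A n.+1 :=
  [ffun h => if unlift ord0 h is Some k then w k else x].

Lemma sum_trajectoryS n (F : trajectory S A n.+1 -> R) :
  \sum_w F w = \sum_x \sum_w F (traj_cons x w).
Proof.
rewrite pair_big /=.
rewrite (reindex (fun u : (S * A) * trajectory S A n => traj_cons u.1 u.2)) //=.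
exists (fun w => (w ord0, [ffun k => w (lift ord0 k)])) => [[x w] _|w _].
  by congr pair; [|apply/ffunP => k]; rewrite !ffunE ?unlift_none ?liftK.
by apply/ffunP => h; rewrite ffunE; case: unliftP => [k|] ->; rewrite ?ffunE.
Qed.

Lemma traj_cons0 n x (w : trajectory S A n) : traj_cons x w ord0 = x.
Proof. by rewrite ffunE unlift_none. Qed.

Lemma traj_cons_lift n x (w : trajectory S A n) k : traj_cons x w (lift ord0 k) = w k.
Proof. by rewrite ffunE liftK. Qed.

Lemma trajectory_prob_cons nu n x (w : trajectory S A n) :
  trajectory_prob (fun s a => nu (s, a)) p P (traj_cons x w) =
  nu x * trajectory_prob (fun s a => pair_kernel x (s, a)) p P w.
Proof.
rewrite /trajectory_prob traj_cons0 -surjective_pairing; congr (_ * _).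
rewrite big_ord_recl /= (_ : widen_ord _ _ = ord0) ?traj_cons0 ?traj_cons_lift;
  last exact: val_inj.
congr (_ * _); apply: eq_bigr => h _.
rewrite (_ : widen_ord _ _ = lift ord0 (widen_ord (leqnSn n) h)) ?traj_cons_lift//.
exact: val_inj.
Qed.

Lemma sum_trajectory0 (F : trajectory S A 0 -> R) :
  \sum_w F w = \sum_x F [ffun=> x].
Proof.
rewrite (reindex (fun x : S * A => [ffun=> x] : trajectory S A 0)) //=.
exists (fun w : trajectory S A 0 => w ord0) => [x _|w _]; first by rewrite ffunE.
by apply/ffunP => h; rewrite ffunE [h]ord1.
Qed.

Lemma expectation1 nu n :
  Defs.expectation (fun s a => nu (s, a)) p P (fun _ : trajectory S A n => 1) = \sum_x nu x.
Proof.
rewrite /Defs.expectation; elim: n nu => [|n IH] nu.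
  rewrite sum_trajectory0; apply: eq_bigr => x _.
  by rewrite /trajectory_prob big_ord0 ffunE -surjective_pairing !mulr1.
rewrite sum_trajectoryS; apply: eq_bigr => x _.
under eq_bigr do rewrite trajectory_prob_cons -mulrA.
by rewrite -mulr_sumr (IH (pair_kernel x)) pair_kernel_sum1 mulr1.
Qed.

(** Conditioning on the first pair turns the rest of the trajectory into one of
    length one less whose initial law is a row of the kernel, which is the
    recursion [truncatedS]. *)
Lemma expectation_truncated g nu f n :
  Defs.expectation (fun s a => nu (s, a)) p P (fun w : trajectory S A n =>
    \sum_(h < n.+1) g ^+ h * f (w h)) = pairing nu (truncated g f n.+1).
Proof.
elim: n nu => [|n IH] nu; rewrite /Defs.expectation /pairing.
  rewrite sum_trajectory0; apply: eq_bigr => x _.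
  rewrite /trajectory_prob big_ord0 ffunE -surjective_pairing mulr1.
  by rewrite /truncated !big_ord_recl !big_ord0 !ffunE.
rewrite sum_trajectoryS; apply: eq_bigr => x _.
under eq_bigr do rewrite trajectory_prob_cons -mulrA big_ord_recl traj_cons0 mul1r mulrDr.
rewrite -mulr_sumr big_split /= -mulr_suml; congr (_ * _).
rewrite truncatedS; congr (_ + _).
  have := expectation1 (pair_kernel x) n; rewrite pair_kernel_sum1 /Defs.expectation.
  by under eq_bigr do rewrite mulr1; move=> ->; rewrite mul1r.
have := IH (pair_kernel x); rewrite /Defs.expectation /pairing /next_mean => <-.
rewrite mulr_sumr; apply: eq_bigr => w _; rewrite mulrCA; congr (_ * _).
by rewrite mulr_sumr; apply: eq_bigr => h _; rewrite traj_cons_lift mulrA -exprS.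
Qed.

(** Both ways of summing the discounted series leave a remainder of this form,
    which vanishes because averaging does not increase the sup norm. *)
Lemma discounted_value_remainder (g : R) nu f (v : R) m f' :
  0 <= g < 1 ->
  (forall n, pairing nu (truncated g f n) = v - g ^+ n * pairing m (iter n next_mean f')) ->
  discounted_value g (fun s a => nu (s, a)) p P (fun s a => f (s, a)) = v.
Proof.
move=> /andP[g0 g1] E; apply/cvg_lim => //.
rewrite (_ : (fun n => _) =
  (fun n => v - g ^+ n.+1 * pairing m (iter n.+1 next_mean f'))); last first.
  apply/funext => n; rewrite -E -expectation_truncated /Defs.expectation.
  by apply: eq_bigr => w _; congr (_ * _); apply: eq_bigr => h _; rewrite -surjective_pairing.
rewrite (cvg_shiftS (fun n => v - g ^+ n * pairing m (iter n next_mean f'))).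
pose rest n := g ^+ n * pairing m (iter n next_mean f').
suff rest0 : rest n @[n --> \oo] --> (0 : R).
  by have := cvgB (cvg_cst v) rest0; rewrite subr0; apply.
(* The sum of the absolute values is a crude bound on the sup norm. *)
pose C := \sum_x `|m x| * \sum_y `|f' y|.
have bound n : `|g ^+ n * pairing m (iter n next_mean f')| <= C * g ^+ n.
  rewrite normrM ger0_norm ?exprn_ge0// mulrC ler_wpM2r ?exprn_ge0//.
  apply: (le_trans (ler_norm_sum _ _ _)); apply: ler_sum => x _.
  rewrite normrM ler_wpM2l//; apply: iter_next_mean_bound => y.
  by rewrite (bigD1 y)//= lerDl sumr_ge0.
apply: norm_cvg0.
apply: (@squeeze_cvgr _ _ _ _ (fun=> 0) (fun n => C * g ^+ n)).
- by near=> n; rewrite normr_ge0 bound.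
- exact: cvg_cst.
- have g_small : `|g| < 1 by rewrite ger0_norm.
  by have := cvgM (cvg_cst (C : R)) (cvg_expr g_small); rewrite mulr0; apply.
Unshelve. all: by end_near. Qed.

(** With K the averaging operator, f = q - g K q makes the series of the
    g^h K^h f telescope. *)
Lemma discounted_value_bellman (g : R) nu f q :
  0 <= g < 1 -> (forall x, q x = f x + g * next_mean q x) ->
  discounted_value g (fun s a => nu (s, a)) p P (fun s a => f (s, a)) = pairing nu q.
Proof.
move=> g01 Eq; apply: (@discounted_value_remainder g nu f _ nu q g01) => n.
rewrite /pairing mulr_sumr -sumrB; apply: eq_bigr => x _.
rewrite mulrCA -mulrBr; congr (_ * _).
elim: n x => [|n IH] x; first by rewrite /truncated big_ord0 expr0 mul1r subrr.
rewrite truncatedS {1}Eq /next_mean (eq_bigr _ (fun y _ => congr1 _ (IH y))).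
under eq_bigr do rewrite mulrBr.
rewrite sumrB mulrBr addrA exprS -mulrA; congr (_ - _ * _).
rewrite iterS /next_mean mulr_sumr; apply: eq_bigr => y _.
by rewrite mulrCA.
Qed.

(** Dually, nu is m - g m K, so pairing nu with the partial sums of the
    g^h K^h f telescopes. *)
Lemma discounted_value_flow (g : R) nu f m :
  0 <= g < 1 -> (forall y, m y = nu y + g * \sum_x m x * pair_kernel x y) ->
  discounted_value g (fun s a => nu (s, a)) p P (fun s a => f (s, a)) = pairing m f.
Proof.
move=> g01 Em; apply: (@discounted_value_remainder g nu f _ m f g01) => n.
have adjoint q : pairing nu q = pairing m q - g * pairing m (next_mean q).
  apply/eqP; rewrite eq_sym subr_eq {1}/pairing; apply/eqP.
  under eq_bigr do rewrite Em mulrDl.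
  rewrite big_split; congr (_ + _).
  under eq_bigr do rewrite -mulrA mulr_suml.
  rewrite -mulr_sumr exchange_big; congr (_ * _).
  apply: eq_bigr => x _; rewrite mulr_sumr; apply: eq_bigr => y _.
  by rewrite mulrA.
rewrite adjoint /pairing !mulr_sumr -!sumrB; apply: eq_bigr => x _.
rewrite !(mulrCA _ (m x)) -!mulrBr; congr (_ * _).
apply/eqP; rewrite subr_eq addrAC eq_sym subr_eq -truncatedS; apply/eqP.
by rewrite /truncated big_ord_recr.
Qed.

(** [M s] is the expected discounted number of visits to [s]. *)
Lemma discounted_value_visits (g : R) (mu0 : S -> R) (f : S -> A -> R) (M : S -> R) :
  0 <= g < 1 ->
  (forall s', M s' = mu0 s' + g * \sum_s \sum_a M s * p s a * P s a s') ->
  discounted_value g (initial_law mu0 p) p P f = \sum_s M s * \sum_a p s a * f s a.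
Proof.
move=> g01 EM.
pose nu x := initial_law mu0 p x.1 x.2; pose m x := M x.1 * p x.1 x.2.
have flow y : m y = nu y + g * \sum_x m x * pair_kernel x y.
  case: y => s' a'; rewrite /m /nu /= {1}EM mulrDl -mulrA; congr (_ + _ * _).
  rewrite /pair_kernel /= mulr_suml.
  rewrite -(pair_big xpredT xpredT (fun s a => M s * p s a * (P s a s' * p s' a'))) /=.
  apply: eq_bigr => s _; rewrite mulr_suml; apply: eq_bigr => a _.
  by rewrite mulrA.
rewrite (discounted_value_flow (fun x => f x.1 x.2) g01 flow) /pairing.
rewrite -(pair_big xpredT xpredT (fun s a => M s * p s a * f s a)) /=.
by apply: eq_bigr => s _; rewrite mulr_sumr; apply: eq_bigr => a _; rewrite mulrA.
Qed.

(** Solving for the cost-to-go [V] of states is enough to know the values of all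
    state-action pairs. *)
Lemma Qvalue_bellman (g : R) (c : S -> A -> R) (V : S -> R) s a :
  0 <= g < 1 ->
  (forall s, V s = \sum_a p s a * (c s a + g * \sum_s' P s a s' * V s')) ->
  Qvalue g c p P s a = c s a + g * \sum_s' P s a s' * V s'.
Proof.
move=> g01 EV.
pose q x := c x.1 x.2 + g * \sum_s' P x.1 x.2 s' * V s'.
have Eq x : q x = c x.1 x.2 + g * next_mean q x.
  congr (_ + _ * _); rewrite /next_mean /pair_kernel.
  rewrite -(pair_big xpredT xpredT (fun s' a' => P x.1 x.2 s' * p s' a' * q (s', a'))) /=.
  apply: eq_bigr => s' _; rewrite EV mulr_sumr.
  by apply: eq_bigr => a' _; rewrite mulrA.
rewrite /Qvalue.
have := discounted_value_bellman (fun x => (x == (s, a))%:R) g01 Eq.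
move=> /= ->.
rewrite /pairing (bigD1 (s, a))//= eqxx mul1r big1 ?addr0// => x /negPf ->.
by rewrite mul0r.
Qed.

End DiscountedValue.

(** * The two kernels and their costs *)

Lemma rev_a1 : rev_ord a1 = a2. Proof. exact: val_inj. Qed.

Lemma ord2P (i k : 'I_2) : k = i \/ k = rev_ord i.
Proof.
by case: i k => [[|[|?]] ?] // [[|[|?]] ?] //;
  solve [left; exact: val_inj | right; exact: val_inj].
Qed.

Lemma rev_ord2_neq (i : 'I_2) : (rev_ord i == i) = false.
Proof. by case: i => [[|[|?]] ?]. Qed.

Lemma sum_ord2 (V : nmodType) (i : 'I_2) (F : 'I_2 -> V) :
  \sum_k F k = F i + F (rev_ord i).
Proof.
rewrite (bigD1 i) //=; congr (_ + _); apply: big_pred1 => k /=.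
case: (ord2P i k) => ->; rewrite eqxx ?rev_ord2_neq //.
by rewrite eq_sym rev_ord2_neq.
Qed.

Lemma sum_state (V : nmodType) (i : 'I_2) (F : state -> V) :
  \sum_s F s = F splus + (F (Some i) + F (Some (rev_ord i))).
Proof.
rewrite (bigD1 splus) //=; congr (_ + _); rewrite -(sum_ord2 i (F \o Some)).
rewrite (reindex_omap Some id) => [|[]//] /=.
by apply: eq_bigl => k; rewrite eqxx.
Qed.

(** The transitions with home state [Some i]; see [P1E] and [P2E]. *)
Definition home_next (i : 'I_2) (s : state) (a : action) : state :=
  if s is Some k then
    if a == a1 then Some i else if k == i then splus else Some k
  else Some (rev_ord i).

Section TwoKernels.
Variable R : realType.
Implicit Types (p : 'M[R]_2) (i j k : 'I_2).

Definition home_kernel i : kernel_fun R state action :=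
  deterministic_kernel R (home_next i).

Lemma P1E : P1 R = home_kernel ord0.
Proof.
rewrite /P1; congr deterministic_kernel; apply/funext => -[k|]; apply/funext => a.
  by case: k a => [[|[|?]] ?] // [[|[|?]] ?] //; rewrite /next1 /home_next //=;
    try congr Some; exact: val_inj.
by rewrite /next1 /home_next /=; try congr Some; exact: val_inj.
Qed.

Lemma P2E : P2 R = home_kernel ord_max.
Proof.
rewrite /P2; congr deterministic_kernel; apply/funext => -[k|]; apply/funext => a.
  by case: k a => [[|[|?]] ?] // [[|[|?]] ?] //; rewrite /next2 /home_next //=;
    try congr Some; exact: val_inj.
by rewrite /next2 /home_next /=; try congr Some; exact: val_inj.
Qed.

Lemma uncertaintyE : @uncertainty R = range home_kernel.
Proof.
apply/seteqP; split => P.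
  by rewrite /uncertainty P1E P2E => -[] ->; [exists ord0|exists ord_max].
case=> i _ <-; rewrite /uncertainty P1E P2E.
by case: (ord2P ord0 i) => ->; [left|right; congr home_kernel; exact: val_inj].
Qed.

Lemma gamma01 : 0 <= gamma R < 1.
Proof. by rewrite /gamma; apply/andP; split; lra. Qed.

Lemma sum_deterministic (next : state -> action -> state) s a (F : state -> R) :
  \sum_s' deterministic_kernel R next s a s' * F s' = F (next s a).
Proof.
rewrite (bigD1 (next s a)) //= /deterministic_kernel eqxx mul1r big1 ?addr0//.
by move=> s' /negPf ->; rewrite mul0r.
Qed.

Section FixedPolicy.
Variables (p : 'M[R]_2) (i : 'I_2).
Hypothesis policies_p : policies p.

Let pi := extend_policy p.
Let x := p i a1.
Let y := p (rev_ord i) a1.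

Lemma policy_a2 k : p k a2 = 1 - p k a1.
Proof.
have [_ /(_ k)] := policies_p; rewrite (sum_ord2 a1) rev_a1.
by move=> <-; rewrite addrC addrK.
Qed.

Lemma policy_a1_01 k : 0 <= p k a1 <= 1.
Proof.
have [p0 _] := policies_p; rewrite p0/= -subr_ge0 -policy_a2; exact: p0.
Qed.

Lemma extend_policy_ge0 s a : 0 <= pi s a.
Proof. by case: s => [k|] /=; [case: policies_p|]. Qed.

Lemma extend_policy_sum1 s : \sum_a pi s a = 1.
Proof.
case: s => [k|] /=; first by case: policies_p.
by rewrite (sum_ord2 a1) rev_a1 /= addr0.
Qed.

Lemma home_kernel_ge0 s a s' : 0 <= home_kernel i s a s'.
Proof. by []. Qed.

Lemma home_kernel_sum1 s a : \sum_s' home_kernel i s a s' = 1.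
Proof.
by under eq_bigr do rewrite -[home_kernel _ _ _ _]mulr1; rewrite sum_deterministic.
Qed.

(** 1000 times the determinant of the identity minus gamma times the transition
    matrix of the states; the flow and Bellman equations are solved by Cramer's
    rule. *)
Definition denom : R := 100 - 90 * x + 171 * y - 81 * x * y.

Lemma denom_gt0 : 0 < denom.
Proof.
by have := policy_a1_01 i; have := policy_a1_01 (rev_ord i); rewrite -/x -/y /denom; nra.
Qed.

(** The solution of the flow equations. *)
Definition visits (s : state) : R :=
  if s is Some k then
    if k == i then (45 + 891 * y) / denom else (1809 - 1701 * x) / (2 * denom)
  else (101 - 99 * x + 1638 * y - 1620 * x * y) / (2 * denom).

(** The cost-to-go, that is, the solution of the Bellman equations. *)
Definition value (s : state) : R :=
  if s is Some k then
    if k == i then 90 * (1 - x) * (1 + 9 * y) / denom else 810 * (1 - x) * y / denom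
  else 10 * (10 - 9 * x) * (1 + 9 * y) / denom.

Lemma visits_flow s' : visits s' =
  mu R s' + gamma R * \sum_s \sum_a visits s * pi s a * home_kernel i s a s'.
Proof.
have d0 : denom != 0 by rewrite gt_eqF ?denom_gt0.
rewrite (sum_state i) !(sum_ord2 a1) rev_a1 /= /home_kernel /deterministic_kernel /=.
rewrite !policy_a2 -/x -/y !eqxx rev_ord2_neq /=.
case: s' => [k|] /=.
  case: (ord2P i k) => ->.
    rewrite !(inj_eq Some_inj) eqxx [i == _]eq_sym rev_ord2_neq /mu /gamma /=.
    by rewrite /denom in d0 *; field.
  rewrite !(inj_eq Some_inj) eqxx rev_ord2_neq /mu /gamma /=.
  by rewrite /denom in d0 *; field.
rewrite /mu /gamma /=.
by rewrite /denom in d0 *; field.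
Qed.

Lemma value_bellman s : value s =
  \sum_a pi s a * (cost R s a + gamma R * \sum_s' home_kernel i s a s' * value s').
Proof.
have d0 : denom != 0 by rewrite gt_eqF ?denom_gt0.
under eq_bigr do rewrite sum_deterministic.
rewrite (sum_ord2 a1) rev_a1 /cost /gamma.
case: s => [k|] /=; last first.
  by rewrite rev_ord2_neq; rewrite /denom in d0 *; field.
rewrite policy_a2; case: (ord2P i k) => -> /=.
  by rewrite -/x !eqxx /=; rewrite /denom in d0 *; field.
by rewrite -/y rev_ord2_neq !eqxx /= rev_ord2_neq; rewrite /denom in d0 *; field.
Qed.

Lemma J_home_kernel : J (home_kernel i) p = visits splus.
Proof.
rewrite /J /expected_cost (discounted_value_visits home_kernel_ge0 home_kernel_sum1
  extend_policy_ge0 extend_policy_sum1 _ gamma01 visits_flow).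
rewrite (sum_state i) !(sum_ord2 a1) rev_a1 /= /cost /=.
by rewrite !(mulr0, mul0r, addr0, mulr1).
Qed.

Lemma gradJ_home_kernel k a :
  gradJ (home_kernel i) p k a = visits (Some k) * (gamma R * value (home_next i (Some k) a)).
Proof.
rewrite mxE /occupancy (discounted_value_visits home_kernel_ge0 home_kernel_sum1
  extend_policy_ge0 extend_policy_sum1 _ gamma01 visits_flow).
rewrite (Qvalue_bellman home_kernel_ge0 home_kernel_sum1
  extend_policy_ge0 extend_policy_sum1 _ _ gamma01 value_bellman).
rewrite sum_deterministic /cost add0r mulKf;
  last by rewrite gt_eqF // subr_gt0; case/andP: gamma01.
congr (_ * _).
under eq_bigr do rewrite -mulr_suml extend_policy_sum1 mul1r.
rewrite (bigD1 (Some k)) // eqxx mulr1 big1 => [|s /negPf ->]; last exact: mulr0.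
exact: addr0.
Qed.

End FixedPolicy.
End TwoKernels.

(** * The local and the global minimum *)

Section Landscape.
Variable R : realType.
Implicit Types (p q u g : 'M[R]_2) (i k : 'I_2).

Lemma sup_pair (a b : R) : sup [set a; b] = Order.max a b.
Proof.
wlog ab : a b / a <= b => [H|].
  by case/orP: (le_total a b) => /H //; rewrite setUC maxC.
rewrite sup_setU; [by rewrite sup1 max_r| |by move=> _ _ -> ->].
by split; [exists b | exists b => _ ->].
Qed.

Lemma robustJE p i :
  robustJ p = Order.max (J (home_kernel R i) p) (J (home_kernel R (rev_ord i)) p).
Proof.
rewrite /robustJ -sup_pair; congr sup; rewrite uncertaintyE.
apply/seteqP; split => [_ [_ [k _ <-] <-]|v].
  by case: (ord2P i k) => ->; [left|right].
by case=> ->; [exists (home_kernel R i)|exists (home_kernel R (rev_ord i))] => //; eexists.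
Qed.

Lemma le_robustJ p i : J (home_kernel R i) p <= robustJ p.
Proof. by rewrite (robustJE p i) le_max lexx. Qed.

Lemma always_policy (a : action) : policies (always R a).
Proof.
split=> [i j|i]; first by rewrite mxE ler0n.
rewrite (bigD1 a) //= big1 ?addr0 ?mxE ?eqxx// => j /negPf ja.
by rewrite mxE ja.
Qed.

Lemma J_always_a2 i : J (home_kernel R i) (always R a2) = 505 / 1000.
Proof.
rewrite (J_home_kernel _ (always_policy a2)) /visits /denom !mxE /=.
by field.
Qed.

Lemma J_always_a1 i : J (home_kernel R i) (always R a1) = 1 / 10.
Proof.
rewrite (J_home_kernel _ (always_policy a1)) /visits /denom !mxE /=.
by field.
Qed.

Lemma robustJ_always_a2 : robustJ (always R a2) = 505 / 1000.
Proof. by rewrite (robustJE _ ord0) !J_always_a2 maxxx. Qed.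

Lemma robustJ_always_a1 : robustJ (always R a1) = 1 / 10.
Proof. by rewrite (robustJE _ ord0) !J_always_a1 maxxx. Qed.

Lemma policy_eq_always_a2 p i : policies p ->
  p i a1 = 0 -> p (rev_ord i) a1 = 0 -> p = always R a2.
Proof.
move=> pp pi0 pr0; apply/matrixP => k a; rewrite mxE.
have pk0 : p k a1 = 0 by case: (ord2P i k) => ->.
by case: (ord2P a1 a) => ->; rewrite ?rev_a1 ?(policy_a2 pp) pk0 ?subr0.
Qed.

(** With x <= y, the first-order change -0.0405 x + 7.326 y from 0.505 is positive
    for y > 0, and it dominates the higher-order terms as long as x <= 1/2. *)
Lemma J_gt_of_le p i : policies p ->
  p i a1 <= p (rev_ord i) a1 -> 0 < p (rev_ord i) a1 -> p i a1 <= 1 / 2 ->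
  505 / 1000 < J (home_kernel R i) p.
Proof.
move=> pp xy y0 x2; have d0 := denom_gt0 i pp.
have := policy_a1_01 pp i; have := policy_a1_01 pp (rev_ord i).
rewrite (J_home_kernel _ pp) /visits ltr_pdivlMr ?mulr_gt0// /denom.
by nra.
Qed.

(** The value 0.505 separates the two costs, since playing a_1 at the home state
    alone only lowers the cost. *)
Lemma J_gt_edge p i : policies p -> p i a1 = 0 -> 0 < p (rev_ord i) a1 ->
  J (home_kernel R (rev_ord i)) p < J (home_kernel R i) p.
Proof.
move=> pp x0 y0; apply: (@lt_trans _ _ (505 / 1000)); last first.
  by apply: J_gt_of_le; rewrite ?x0 // ?ltW//; lra.
have d0 := denom_gt0 (rev_ord i) pp.
have := policy_a1_01 pp (rev_ord i).
rewrite (J_home_kernel _ pp) /visits ltr_pdivrMr ?mulr_gt0// /denom rev_ordK x0.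
by nra.
Qed.

Lemma strict_local_min_always_a2 :
  strict_local_min (@robustJ R) (@policies R) (always R a2).
Proof.
split; first exact: always_policy.
apply/nbhs_ballP; exists (1 / 2) => /=; first by lra.
move=> p; rewrite mx_norm_ball /ball_ /= => /ltW near_p pp p_neq.
rewrite robustJ_always_a2.
have small k : p k a1 <= 1 / 2.
  have : `|(always R a2 - p) k a1| <= 1 / 2.
    apply: le_trans near_p; rewrite [leRHS]/Num.Def.normr/= mx_normrE.
    exact: (le_bigmax _ _ (k, a1)).
  by rewrite !mxE ler_norml /=; lra.
have [i le_i] : exists i, p i a1 <= p (rev_ord i) a1.
  have [?|/ltW ?] := leP (p ord0 a1) (p (rev_ord ord0) a1); first by exists ord0.
  by exists (rev_ord ord0); rewrite rev_ordK.
have [xi0 _] := andP (policy_a1_01 pp i).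
have y0 : 0 < p (rev_ord i) a1.
  rewrite lt_neqAle eq_sym (le_trans xi0 le_i) andbT; apply/eqP => r0.
  apply/p_neq/(policy_eq_always_a2 (i := i)) => //.
  by apply/eqP; rewrite eq_le xi0 -r0 le_i.
exact: lt_le_trans (J_gt_of_le pp le_i y0 (small i)) (le_robustJ p i).
Qed.

(** * Subgradients near the always-a_2 policy *)

(** Half-spaces are convex. *)
Lemma convex_hull_ge m n (C : set 'M[R]_(m.+1, n.+1))
    (L : 'M[R]_(m.+1, n.+1) -> R) (c : R) :
  (forall (t : R) (u v : 'M[R]_(m.+1, n.+1)),
    L (t *: u + (1 - t) *: v) = t * L u + (1 - t) * L v) ->
  (forall u : 'M[R]_(m.+1, n.+1), C u -> c <= L u) ->
  forall u : 'M[R]_(m.+1, n.+1), convex_hull C u -> c <= L u.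
Proof.
move=> L_affine CL.
apply: (@smallest_sub _ _ C [set u : 'M[R]_(m.+1, n.+1) | c <= L u]) => // u v t.
move=> /[!inE] /= cu cv.
have t01 : 0 <= t%:num <= 1 by rewrite ge0 le1.
rewrite [X in L X](_ : _ = t%:num *: u + (1 - t%:num) *: v) // L_affine.
by nra.
Qed.

(** When the probability of [a1] in row [k] grows, that of [a2] decreases, so a
    gradient [u] acts on a policy only through these differences. *)
Definition slope u k : R := u k a1 - u k a2.

Lemma slope_affine k t u v :
  slope (t *: u + (1 - t) *: v) k = t * slope u k + (1 - t) * slope v k.
Proof. by rewrite /slope !mxE; ring. Qed.

(** The slopes are about -0.04 and 7.33 at the always-a_2 policy; the bounds are
    the weakest for which a step of size eta moves a coordinate up by at most
    eta, and brings a coordinate down from eta to 0. *)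
Lemma gradJ_slopes p i : policies p -> p i a1 = 0 -> p (rev_ord i) a1 <= 1 / 100 ->
  -2 <= slope (gradJ (home_kernel R i) p) i /\
  2 <= slope (gradJ (home_kernel R i) p) (rev_ord i).
Proof.
move=> pp x0 y_small; have d0 := denom_gt0 i pp.
have := policy_a1_01 pp (rev_ord i).
rewrite /slope !(gradJ_home_kernel _ pp) /visits /value /home_next /=.
rewrite rev_ord2_neq !eqxx /= rev_ord2_neq /gamma.
have dE : denom p i = 100 + 171 * p (rev_ord i) a1 by rewrite /denom x0; ring.
rewrite dE in d0 *; rewrite x0; move: (p (rev_ord i) a1) y_small d0 => y ys d0 /andP[y0 _].
have d1 : 100 + 171 * y != 0 by rewrite gt_eqF.
split.
  rewrite [leRHS](_ : _ =
    - (81 * (5 + 99 * y) * (1 + 9 * y)) / (100 + 171 * y) ^+ 2); last by field.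
  by rewrite ler_pdivlMr ?exprn_gt0//; nra.
rewrite [leRHS](_ : _ = 81 * 1809 / 2 / (100 + 171 * y) ^+ 2); last by field.
by rewrite ler_pdivlMr ?exprn_gt0//; nra.
Qed.

(** Off the vertex only one kernel attains the worst case ([J_gt_edge]). *)
Lemma subdifferential_edge p i g : policies p -> p i a1 = 0 ->
  0 < p (rev_ord i) a1 <= 1 / 100 -> subdifferential p g ->
  -2 <= slope g i /\ 2 <= slope g (rev_ord i).
Proof.
move=> pp x0 /andP[y0 ys] gp; have [s1 s2] := gradJ_slopes pp x0 ys.
have active u : [set gradJ P p | P in [set P | uncertainty P /\ J P p = robustJ p]] u ->
    u = gradJ (home_kernel R i) p.
  case=> P [+ JP] <-; rewrite uncertaintyE => -[k _ Pk]; move: JP; rewrite -Pk.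
  case: (ord2P i k) => -> // JE; have := J_gt_edge pp x0 y0.
  by rewrite JE ltNge le_robustJ.
split; apply: (convex_hull_ge (slope_affine _) _ gp) => u /active -> //.
Qed.

(** Here both kernels attain the worst case, and the subgradient may be any
    mixture; the half-space on the sum of the slopes survives because the bounds
    -2 and 2 of [gradJ_slopes] cancel. *)
Lemma subdifferential_always_a2 g k : subdifferential (always R a2) g ->
  [/\ -2 <= slope g k & 0 <= slope g k + slope g (rev_ord k)].
Proof.
move=> gp.
have slopes u : [set gradJ P (always R a2) | P in
      [set P | uncertainty P /\ J P (always R a2) = robustJ (always R a2)]] u ->
    -2 <= slope u k /\ 0 <= slope u k + slope u (rev_ord k).
  case=> P [+ _] <-; rewrite uncertaintyE => -[i _ <-].
  have [] := @gradJ_slopes (always R a2) i (always_policy a2).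
  - by rewrite mxE.
  - by rewrite mxE /=; lra.
  by case: (ord2P i k) => ->; rewrite ?rev_ordK; move=> h1 h2; split; lra.
split; first by apply: (convex_hull_ge (slope_affine _) _ gp) => u /slopes[].
apply: (@convex_hull_ge _ _ _ (fun u => slope u k + slope u (rev_ord k)) _ _ _ _ gp).
  by move=> t u v; rewrite !slope_affine; ring.
by move=> u /slopes[].
Qed.

(** * Projected steps *)

Lemma sum_sqr_rows u k : \sum_i \sum_j u i j ^+ 2 =
  u k a1 ^+ 2 + u k a2 ^+ 2 + (u (rev_ord k) a1 ^+ 2 + u (rev_ord k) a2 ^+ 2).
Proof. by rewrite (sum_ord2 k); congr (_ + _); rewrite (sum_ord2 a1) rev_a1. Qed.

(** The policies form a product of segments, and as a function of the probability
    of [a1] in row [k] the squared distance to [q] is, up to a constant, twice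
    the squared distance to (1 + [slope q k]) / 2. *)
Lemma proj_policies_le q p k : is_proj (@policies R) q p ->
  p k a1 <= Order.max 0 ((1 + slope q k) / 2).
Proof.
case=> pp min_p; rewrite leNgt; apply/negP => lt_max.
set t := Order.max _ _ in lt_max.
have t0 : 0 <= t by rewrite le_max lexx.
have ts : (1 + slope q k) / 2 <= t by rewrite le_max lexx orbT.
have [_ pk1] := andP (policy_a1_01 pp k).
(* Lowering the entry of row k to t would yield a closer policy. *)
pose z : 'M[R]_2 := \matrix_(i, a) if i == k then (if a == a1 then t else 1 - t) else p i a.
have z_policy : policies z.
  have [p0 p1] := pp; split=> [i a|i].
    by rewrite mxE; case: ifP => // _; case: ifP => // _; lra.
  case: (eqVneq i k) => [->|/negPf ik].
    by rewrite (sum_ord2 a1) rev_a1 !mxE !eqxx /=; ring.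
  by rewrite -[RHS](p1 i); apply: eq_bigr => a _; rewrite mxE ik.
have := min_p z z_policy.
rewrite /euclidean_norm ler_sqrt; last by do 2! apply: sumr_ge0 => ? _; exact: sqr_ge0.
rewrite leNgt => /negP; apply.
rewrite !(sum_sqr_rows _ k) !mxE !eqxx rev_ord2_neq /=.
rewrite ltrD2r !(policy_a2 pp); move: ts; rewrite /slope.
by nra.
Qed.

Lemma step_le eta p g p' k : policies p ->
  is_proj (@policies R) (p - eta *: g) p' ->
  p' k a1 <= Order.max 0 (p k a1 - eta / 2 * slope g k).
Proof.
move=> pp /(proj_policies_le k) /le_trans; apply.
rewrite [X in Order.max 0 X](_ : _ = p k a1 - eta / 2 * slope g k) //.
by rewrite /slope !mxE (policy_a2 pp); field.
Qed.

(** Edges alternate: from x = 0 < y the step returns y to 0, hence lands on the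
    other edge or at the vertex. *)
Lemma step_invariant eta p g p' : 0 < eta <= 1 / 100 -> policies p ->
  (exists2 i, p i a1 = 0 & p (rev_ord i) a1 <= eta) ->
  subdifferential p g -> is_proj (@policies R) (p - eta *: g) p' ->
  exists2 i, p' i a1 = 0 & p' (rev_ord i) a1 <= eta.
Proof.
move=> /andP[eta0 eta_small] pp [i x0 y_le] gp proj_p'; have [pp' _] := proj_p'.
have p'_ge0 k : 0 <= p' k a1 by case/andP: (policy_a1_01 pp' k).
suff [k k0 k_le] : exists2 k, p k a1 - eta / 2 * slope g k <= 0 &
    p (rev_ord k) a1 - eta / 2 * slope g (rev_ord k) <= eta.
  exists k.
    by apply/eqP; rewrite eq_le p'_ge0 andbT (le_trans (step_le k pp proj_p'))// ge_max lexx.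
  by rewrite (le_trans (step_le _ pp proj_p'))// ge_max k_le ltW.
have [y_ge0 _] := andP (policy_a1_01 pp (rev_ord i)).
case: (eqVneq (p (rev_ord i) a1) 0) => [y0|y_neq0].
  have pE := policy_eq_always_a2 pp x0 y0; rewrite pE in gp *.
  have [k slope_k] : exists k, 0 <= slope g k.
    have [_ sum_ge0] := subdifferential_always_a2 ord0 gp.
    have [?|neg] := leP 0 (slope g ord0); first by exists ord0.
    by exists (rev_ord ord0); lra.
  have [slope_r _] := subdifferential_always_a2 (rev_ord k) gp.
  by exists k; rewrite mxE /=; nra.
have y01 : 0 < p (rev_ord i) a1 <= 1 / 100.
  by rewrite lt_neqAle eq_sym y_neq0 y_ge0 (le_trans y_le).
have [slope_i slope_r] := subdifferential_edge pp x0 y01 gp.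
by exists (rev_ord i); rewrite ?rev_ordK ?x0; nra.
Qed.

Lemma dist_always_a2 p (e : R) : policies p -> 0 <= e ->
  (forall k, p k a1 <= e) -> `|p - always R a2| <= e.
Proof.
move=> pp e0 pe; rewrite /Num.Def.normr/= mx_normrE (bigmax_le _ e0)//= => -[k a] _.
have := policy_a1_01 pp k; have := pe k.
by case: (ord2P a1 a) => ->; rewrite ?rev_a1 !mxE ?(policy_a2 pp) ler_norml /=; lra.
Qed.

End Landscape.

Theorem proposition8 (R : realType) :
  [/\ strict_local_min (@robustJ R) (@policies R) (always R a2),
      ~ global_min (@robustJ R) (@policies R) (always R a2),
      robustJ (always R a2) = 505 / 1000,
      robustJ (always R a1) < robustJ (always R a2) &
      robustJ (always R a1) = 1 / 10] /\
  (exists2 eta0 : R, 0 < eta0 &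
     forall eta : R, 0 < eta < eta0 ->
     forall p g : nat -> 'M[R]_2,
       p 0%N = always R a2 -> subgradient_run eta p g ->
       forall t : nat, `|p t - always R a2| <= 3 * eta).
Proof.
have lt12 : robustJ (always R a1) < robustJ (always R a2).
  by rewrite robustJ_always_a1 robustJ_always_a2; lra.
split.
  split=> //; first exact: strict_local_min_always_a2.
  - by case=> _ /(_ _ (always_policy R a1)); rewrite leNgt lt12.
  - exact: robustJ_always_a2.
  - exact: robustJ_always_a1.
exists (1 / 100); first by lra.
move=> eta /andP[eta0 eta1] p g p0 run t.
have pp s : policies (p s).
  by case: s => [|s]; [rewrite p0; exact: always_policy|have [_ []] := run s].
suff [i x0 y_le] : exists2 i, p t i a1 = 0 & p t (rev_ord i) a1 <= eta.
  apply: dist_always_a2 => // [|k]; first by lra.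
  by case: (ord2P i k) => ->; [rewrite x0|]; lra.
elim: t => [|t IH]; first by exists ord0; rewrite p0 mxE //= ltW.
have [gt proj_t] := run t.
by apply: step_invariant IH gt proj_t => //; rewrite eta0 ltW.
Qed.
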